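(* Every formula deducible in Markov arithmetic $\mathsf{MA}$ is deducible in $\mathsf{CA}$.
   Context: **Languages.** $LA$ is the language of formal arithmetic with $0,s,+,\cdot,=$. $\mathsf{HA}$ is intuitionistic (Heyting) arithmetic in $LA$: intuitionistic predicate calculus $\mathsf{IQC}$ plus the Peano axioms with full induction scheme. $\Phi\leftrightarrow\Psi$ abbreviates $(\Phi\to\Psi)\,\&\,(\Psi\to\Phi)$. $L$ is the language of predicate formulas built from predicate variables (of all arities) without function symbols, constants or equality; $Z,E,S,A,M$ are fixed distinct predicate variables of arities $1,2,2,3,3$, and $P,R$ are further predicate variables of arities $1$ and $2$. Formulas built from $Z,E,S,A,M$ only are called $Ar$-formulas; read arithmetically, $Z(x),E(x,y),S(x,y),A(x,y,z),M(x,y,z)$ stand for $x=0$, $x=y$, $sx=y$, $x+y=z$, $x\cdot y=z$, which turns each $Ar$-formula $\Phi$ into an $LA$-formula $\Phi^\circ$. **The formula $Q$.** $x\le y$ abbreviates $\exists z\,A(z,x,y)$ in $Ar$. $\Delta_0$-formulas are built from atomic $Ar$-formulas by $\neg,\lor,\&,\to$ and bounded quantifiers $(\exists x\le t),(\forall x\le t)$ ($t\ne x$), i.e. $\exists x(x\le t\,\&\,\cdot)$, $\forall x(x\le t\to\cdot)$; $\Sigma$-formulas are built from $\Delta_0$-formulas by $\lor,\&$, bounded quantifiers and $\exists x$. $\{x\}$ is the unary partial recursive function with Gödel number $x$. $G(x,y,z)$ is a fixed $\Sigma$-formula of $Ar$ defining $\{x\}(y)=z$ in the standard model such that $\mathsf{HA}$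 proves (the arithmetical reading of) $\forall x,y,z_1,z_2(G(x,y,z_1)\,\&\,G(x,y,z_2)\to z_1=z_2)$. $H(x,y)$ is $\exists z(Z(z)\,\&\,G(x,y,z))$. Let $\mathsf c(x,y)=\frac{(x+y)(x+y+1)}2+x$ be the pairing function with projections $\mathsf l,\mathsf r$ ($\mathsf c(\mathsf l(x),\mathsf r(x))=x$), $\mathsf l_*(x,0)=x$, $\mathsf l_*(x,y+1)=\mathsf l(\mathsf l_*(x,y))$, $\mathsf g(x,y)=\mathsf r(\mathsf l_*(x,y))$; $B(u,v)$ is the $Ar$-formula obtained from $\mathsf g(u,v)=1$ by the standard elimination of primitive recursive function symbols via $\Sigma$-formulas provably representing them in $\mathsf{HA}$. $Q$ is the conjunction of: $A_1$: $\forall x,y,z(S(x,z)\,\&\,S(y,z)\to E(x,y))$; $A_2$: $\forall x,y(S(x,y)\to\neg Z(y))$; $A_3$: $\forall x,y,z(E(x,y)\,\&\,E(x,z)\to E(y,z))$; $A_4$: $\forall x,y,z(E(x,y)\,\&\,S(x,z)\to S(y,z))$; $A_5$: $\forall x,y(Z(y)\to A(x,y,x))$; $A_6$: $\forall x,y,z,u,v(S(y,z)\,\&\,A(x,y,u)\,\&\,S(u,v)\to A(x,z,v))$; $A_7$: $\forall x,y(Z(y)\to M(x,y,y))$; $A_8$: $\forall x,y,z,u,v(S(y,z)\,\&\,M(x,y,u)\,\&\,A(u,x,v)\to M(x,z,v))$; $A_9$: $\forall x_1,x_2,y,z(E(x_1,x_2)\,\&\,A(x_1,y,z)\to A(x_2,y,z))$;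 $A_{10}$: $\forall x,y_1,y_2,z(E(y_1,y_2)\,\&\,A(x,y_1,z)\to A(x,y_2,z))$; $A_{11}$: $\forall x_1,x_2,y,z(E(x_1,x_2)\,\&\,M(x_1,y,z)\to M(x_2,y,z))$; $A_{12}$: $\forall x,y_1,y_2,z(E(y_1,y_2)\,\&\,M(x,y_1,z)\to M(x,y_2,z))$; $A_{13}$: $\forall x(Z(x)\lor\exists y\,S(y,x))$; $A_{14}$: $\exists x\,Z(x)$; $A_{15}$: $\forall x,y(Z(x)\,\&\,Z(y)\to E(x,y))$; $A_{16}$: $\forall x,y(E(x,y)\,\&\,Z(x)\to Z(y))$; $A_{17}$: $\forall x\exists y\,S(x,y)$; $A_{18}$: $\forall x,y,z(S(x,y)\,\&\,S(x,z)\to E(y,z))$; $A_{19}$: $\forall x,y,z(S(x,y)\,\&\,E(y,z)\to S(x,z))$; $A_{20}$: $\forall x,y\exists z\,A(x,y,z)$; $A_{21}$: $\forall x,y,z_1,z_2(A(x,y,z_1)\,\&\,A(x,y,z_2)\to E(z_1,z_2))$; $A_{22}$: $\forall x,y,z_1,z_2(A(x,y,z_1)\,\&\,E(z_1,z_2)\to A(x,y,z_2))$; $A_{23}$: $\forall x,y\exists z\,M(x,y,z)$; $A_{24}$: $\forall x,y,z_1,z_2(M(x,y,z_1)\,\&\,M(x,y,z_2)\to E(z_1,z_2))$; $A_{25}$: $\forall x,y,z_1,z_2(M(x,y,z_1)\,\&\,E(z_1,z_2)\to M(x,y,z_2))$; $A_{26}$: $\forall x,y,z_1,z_2(G(x,y,z_1)\,\&\,G(x,y,z_2)\to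 E(z_1,z_2))$; $A_{27}$: $\forall y,z\,\neg\neg\exists v\forall x(x\le z\to(B(v,x)\leftrightarrow H(y,x)))$; $A_{28}$: $\forall x\forall y(B(x,y)\lor\neg B(x,y))$. **The theories.** The equality axiom for an $n$-ary $P'$ is $\forall\vec x\forall\vec y(E(x_1,y_1)\,\&\dots\&\,E(x_n,y_n)\to(P'(\vec x)\to P'(\vec y)))$; $Eq(E,P_1,\dots,P_m)$ is the conjunction of the equality axioms for $P_1,\dots,P_m$. $M$ (Markov principle) is the formula $\forall x(P(x)\lor\neg P(x))\,\&\,\neg\neg\exists x\,P(x)\to\exists x\,P(x)$. $nCT$ is $\forall x(\neg P(x)\to\exists y\,R(x,y))\to\exists z\forall x(\neg P(x)\to\exists y(G(z,x,y)\,\&\,R(x,y)))$, and $nCT^*$ is the predicate formula $Q\,\&\,Eq(E,P,R)\to nCT$, in which $Z,E,S,A,M$ (also inside $G$) are treated as predicate variables. A substitutional instance of a predicate formula is obtained by replacing its predicate variables by formulas of a given language: each atomic subformula $P_i(v_1,\dots,v_k)$ is replaced by $\Psi_i$ with $v_1,\dots,v_k$ simultaneously substituted for the designated variables $x_1,\dots,x_k$, provided no variable capture occurs. $\mathsf{MQC}$ is $\mathsf{IQC}$ with all substitutional instances of $M$ and $nCT^*$ (including those for $Z,E,S,A,M$) added as axioms. $\mathsf{CA}$ is the theory in the language $LA$ with the Peano axioms (including induction) based on the calculus $\mathsf{MQC}$; i.e. $\mathsf{HA}$ plus all substitutional instances of $M$ and $nCT^*$ by $LA$-formulas. $\mathsf{MA}$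 (Markov arithmetic) is $\mathsf{HA}$ plus all $LA$-formulas $\forall x(\Phi(x)\lor\neg\Phi(x))\,\&\,\neg\neg\exists x\,\Phi(x)\to\exists x\,\Phi(x)$ and all $LA$-formulas $\forall x(\neg\Phi(x)\to\exists y\,\Psi(x,y))\to\exists z\forall x(\neg\Phi(x)\to\exists y(G^\circ(z,x,y)\,\&\,\Psi(x,y)))$ with $\Phi,\Psi$ arbitrary (equivalently, $\mathsf{HA}$ plus Markov's principle and the extended Church thesis). *)

(* Defs.v *)
From Stdlib Require Import List Arith.
Import ListNotations.

(** * Formulas

    Variables are de Bruijn indices: under a quantifier, index 0 is the variable
    it binds.  The syntax is shared by the predicate language [L] and by the
    language of arithmetic [LA], which differ in their atoms. *)

Inductive form (atom : Type) : Type :=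
| Atom (a : atom)
| Bot
| And (A B : form atom)
| Or (A B : form atom)
| Imp (A B : form atom)
| All (A : form atom)
| Ex (A : form atom).

Arguments Atom {atom} a.
Arguments Bot {atom}.
Arguments And {atom} A B.
Arguments Or {atom} A B.
Arguments Imp {atom} A B.
Arguments All {atom} A.
Arguments Ex {atom} A.

Definition Neg {atom} (A : form atom) : form atom := Imp A Bot.
Definition Iff {atom} (A B : form atom) : form atom := And (Imp A B) (Imp B A).

Declare Scope form_scope.
Delimit Scope form_scope with form.
Bind Scope form_scope with form.
Notation "¬ A" := (Neg A) (at level 75, right associativity) : form_scope.
Notation "A ∧ B" := (And A B) (at level 80, right associativity) : form_scope.
Notation "A ∨ B" := (Or A B) (at level 85, right associativity) : form_scope.
Notation "A ⇒ B" := (Imp A B) (at level 99, right associativity) : form_scope.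
Notation "A ⇔ B" := (Iff A B) (at level 95, no associativity) : form_scope.
Local Open Scope form_scope.

(** Universal prefixes.  The matrix receives the indices of the bound variables,
    outermost first; these are correct only at quantifier depth 0 inside it. *)
Definition all2 {atom} (f : nat -> nat -> form atom) : form atom :=
  All (All (f 1 0)).
Definition all3 {atom} (f : nat -> nat -> nat -> form atom) : form atom :=
  All (All (All (f 2 1 0))).
Definition all4 {atom} (f : nat -> nat -> nat -> nat -> form atom) : form atom :=
  All (All (All (All (f 3 2 1 0)))).
Definition all5 {atom} (f : nat -> nat -> nat -> nat -> nat -> form atom) : form atom :=
  All (All (All (All (All (f 4 3 2 1 0))))).

Fixpoint bigand {atom} (A : form atom) (l : list (form atom)) : form atom :=
  match l with
  | [] => A
  | B :: l' => A ∧ bigand B l'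
  end.

(** * The arithmetical language LA *)

Inductive term : Type :=
| Var (n : nat)
| Zero
| Succ (t : term)
| Plus (t u : term)
| Mult (t u : term).

Definition aform : Type := form (term * term).
Bind Scope form_scope with aform.
Notation "t ≈ u" := (@Atom (term * term) (t, u)) (at level 70, no associativity) : form_scope.

Fixpoint tsubst (s : nat -> term) (t : term) : term :=
  match t with
  | Var n => s n
  | Zero => Zero
  | Succ t => Succ (tsubst s t)
  | Plus t u => Plus (tsubst s t) (tsubst s u)
  | Mult t u => Mult (tsubst s t) (tsubst s u)
  end.

Definition tshift : term -> term := tsubst (fun n => Var (S n)).

Definition up (s : nat -> term) (n : nat) : term :=
  match n with
  | 0 => Var 0
  | S m => tshift (s m)
  end.

Fixpoint asubst (s : nat -> term) (A : aform) : aform :=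
  match A with
  | Atom (t, u) => Atom (tsubst s t, tsubst s u)
  | Bot => Bot
  | And A B => And (asubst s A) (asubst s B)
  | Or A B => Or (asubst s A) (asubst s B)
  | Imp A B => Imp (asubst s A) (asubst s B)
  | All A => All (asubst (up s) A)
  | Ex A => Ex (asubst (up s) A)
  end.

Definition ashift : aform -> aform := asubst (fun n => Var (S n)).

(** [inst1 A t] substitutes [t] for index 0 and lowers the other indices. *)
Definition inst1 (A : aform) (t : term) : aform :=
  asubst (fun n => match n with 0 => t | S m => Var m end) A.

Fixpoint teval (e : nat -> nat) (t : term) : nat :=
  match t with
  | Var n => e n
  | Zero => 0
  | Succ t => S (teval e t)
  | Plus t u => teval e t + teval e u
  | Mult t u => teval e t * teval e u
  end.

Definition scons (x : nat) (e : nat -> nat) (n : nat) : nat :=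
  match n with 0 => x | S m => e m end.

(** Truth in the standard model. *)
Fixpoint sat (e : nat -> nat) (A : aform) : Prop :=
  match A with
  | Atom (t, u) => teval e t = teval e u
  | Bot => False
  | And A B => sat e A /\ sat e B
  | Or A B => sat e A \/ sat e B
  | Imp A B => sat e A -> sat e B
  | All A => forall x, sat (scons x e) A
  | Ex A => exists x, sat (scons x e) A
  end.

(** Intuitionistic predicate calculus (natural deduction) with additional axioms
    [T].  Axioms may contain free variables and may be generalized over them. *)
Inductive prv (T : aform -> Prop) : list aform -> aform -> Prop :=
| prv_ax G A : T A -> prv T G A
| prv_hyp G A : In A G -> prv T G A
| prv_botE G A : prv T G Bot -> prv T G A
| prv_andI G A B : prv T G A -> prv T G B -> prv T G (A ∧ B)
| prv_andE1 G A B : prv T G (A ∧ B) -> prv T G A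
| prv_andE2 G A B : prv T G (A ∧ B) -> prv T G B
| prv_orI1 G A B : prv T G A -> prv T G (A ∨ B)
| prv_orI2 G A B : prv T G B -> prv T G (A ∨ B)
| prv_orE G A B C :
    prv T G (A ∨ B) -> prv T (A :: G) C -> prv T (B :: G) C -> prv T G C
| prv_impI G A B : prv T (A :: G) B -> prv T G (A ⇒ B)
| prv_impE G A B : prv T G (A ⇒ B) -> prv T G A -> prv T G B
| prv_allI G A : prv T (map ashift G) A -> prv T G (All A)
| prv_allE G A t : prv T G (All A) -> prv T G (inst1 A t)
| prv_exI G A t : prv T G (inst1 A t) -> prv T G (Ex A)
| prv_exE G A C :
    prv T G (Ex A) -> prv T (A :: map ashift G) (ashift C) -> prv T G C.

Definition deducible (T : aform -> Prop) (A : aform) : Prop := prv T [] A.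

Inductive HA_ax : aform -> Prop :=
| HA_refl t : HA_ax (t ≈ t)
| HA_leibniz A t u : HA_ax (t ≈ u ⇒ inst1 A t ⇒ inst1 A u)
| HA_succ_neq t : HA_ax (¬ (Succ t ≈ Zero))
| HA_succ_inj t u : HA_ax (Succ t ≈ Succ u ⇒ t ≈ u)
| HA_plus0 t : HA_ax (Plus t Zero ≈ t)
| HA_plusS t u : HA_ax (Plus t (Succ u) ≈ Succ (Plus t u))
| HA_mult0 t : HA_ax (Mult t Zero ≈ Zero)
| HA_multS t u : HA_ax (Mult t (Succ u) ≈ Plus (Mult t u) t)
| HA_ind A :
    let step :=
      asubst (fun n => match n with 0 => Succ (Var 0) | S m => Var (S m) end) A in
    HA_ax (inst1 A Zero ∧ All (A ⇒ step) ⇒ All A).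

Definition HA : aform -> Prop := deducible HA_ax.

(** * The predicate language L

    A predicate variable is a pair (index, arity); [(i, args)] is the atom of the
    [i]-th predicate variable of arity [length args]. *)

Definition pform : Type := form (nat * list nat).
Bind Scope form_scope with pform.

Definition pZ x : pform := Atom (0, [x]).
Definition pE x y : pform := Atom (0, [x; y]).
Definition pS x y : pform := Atom (1, [x; y]).
Definition pA x y z : pform := Atom (0, [x; y; z]).
Definition pM x y z : pform := Atom (1, [x; y; z]).
Definition pP x : pform := Atom (1, [x]).
Definition pR x y : pform := Atom (2, [x; y]).

Definition upr (r : nat -> nat) (n : nat) : nat :=
  match n with 0 => 0 | S m => S (r m) end.

Fixpoint prename (r : nat -> nat) (A : pform) : pform :=
  match A with
  | Atom (i, args) => Atom (i, map r args)
  | Bot => Bot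
  | And A B => And (prename r A) (prename r B)
  | Or A B => Or (prename r A) (prename r B)
  | Imp A B => Imp (prename r A) (prename r B)
  | All A => All (prename (upr r) A)
  | Ex A => Ex (prename (upr r) A)
  end.

(** [papp F [x; y; ...]] is [F(x,y,...)], where indices 0, 1, ... of [F] are its
    first, second, ... argument. *)
Definition papp (F : pform) (args : list nat) : pform :=
  prename (fun n => nth n args 0) F.

(** All free variables are among the indices below [n]. *)
Fixpoint fv_below (n : nat) (A : pform) : Prop :=
  match A with
  | Atom (_, args) => Forall (fun v => v < n) args
  | Bot => True
  | And A B | Or A B | Imp A B => fv_below n A /\ fv_below n B
  | All A | Ex A => fv_below (S n) A
  end.

(** LA-instance of a formula of L: the atom [P(v_0,...,v_(k-1))] of the [i]-th
    [k]-ary predicate variable becomes [Psi i k] with [v_j] substituted for index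
    [j < k].  The index [k + j] of [Psi i k] is a parameter denoting the free
    variable [j] of the resulting formula, never captured by the [d] quantifiers
    crossed so far. *)
Fixpoint instance (Psi : nat -> nat -> aform) (d : nat) (A : pform) : aform :=
  match A with
  | Atom (i, args) =>
      asubst (fun n => match nth_error args n with
                       | Some v => Var v
                       | None => Var (n - length args + d)
                       end)
             (Psi i (length args))
  | Bot => Bot
  | And A B => And (instance Psi d A) (instance Psi d B)
  | Or A B => Or (instance Psi d A) (instance Psi d B)
  | Imp A B => Imp (instance Psi d A) (instance Psi d B)
  | All A => All (instance Psi (S d) A)
  | Ex A => Ex (instance Psi (S d) A)
  end.

(** Arithmetical reading of Z, E, S, A, M; the value [Bot] for the other
    predicate variables is irrelevant to Ar-formulas. *)
Definition arith (i k : nat) : aform :=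
  match i, k with
  | 0, 1 => Var 0 ≈ Zero
  | 0, 2 => Var 0 ≈ Var 1
  | 1, 2 => Succ (Var 0) ≈ Var 1
  | 0, 3 => Plus (Var 0) (Var 1) ≈ Var 2
  | 1, 3 => Mult (Var 0) (Var 1) ≈ Var 2
  | _, _ => Bot
  end.

Definition circ (A : pform) : aform := instance arith 0 A.

(** * Sigma-formulas *)

Definition ple (x y : nat) : pform := Ex (pA 0 (S x) (S y)).

(** [t] is a variable outside the quantifier, hence distinct from the bound one. *)
Definition ball (t : nat) (A : pform) : pform := All (ple 0 (S t) ⇒ A).
Definition bex (t : nat) (A : pform) : pform := Ex (ple 0 (S t) ∧ A).

Inductive delta0 : pform -> Prop :=
| delta0_Z x : delta0 (pZ x)
| delta0_E x y : delta0 (pE x y)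
| delta0_S x y : delta0 (pS x y)
| delta0_A x y z : delta0 (pA x y z)
| delta0_M x y z : delta0 (pM x y z)
| delta0_neg A : delta0 A -> delta0 (¬ A)
| delta0_or A B : delta0 A -> delta0 B -> delta0 (A ∨ B)
| delta0_and A B : delta0 A -> delta0 B -> delta0 (A ∧ B)
| delta0_imp A B : delta0 A -> delta0 B -> delta0 (A ⇒ B)
| delta0_ball t A : delta0 A -> delta0 (ball t A)
| delta0_bex t A : delta0 A -> delta0 (bex t A).

Inductive sigma : pform -> Prop :=
| sigma_delta0 A : delta0 A -> sigma A
| sigma_or A B : sigma A -> sigma B -> sigma (A ∨ B)
| sigma_and A B : sigma A -> sigma B -> sigma (A ∧ B)
| sigma_ball t A : sigma A -> sigma (ball t A)
| sigma_bex t A : sigma A -> sigma (bex t A)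
| sigma_ex A : sigma A -> sigma (Ex A).

(** * Partial recursive functions and their Gödel numbers *)

Inductive recfun : Type :=
| RZero
| RSucc
| RProj (i : nat)
| RComp (f : recfun) (gs : list recfun)
| RPrec (f g : recfun)
| RMu (f : recfun).

(** Arities are not tracked: an expression used with an unsuitable number of
    arguments is merely undefined there. *)
Inductive reval : recfun -> list nat -> nat -> Prop :=
| reval_zero xs : reval RZero xs 0
| reval_succ x : reval RSucc [x] (S x)
| reval_proj i xs y : nth_error xs i = Some y -> reval (RProj i) xs y
| reval_comp f gs xs ys z :
    Forall2 (fun g y => reval g xs y) gs ys -> reval f ys z ->
    reval (RComp f gs) xs z
| reval_prec0 f g xs z : reval f xs z -> reval (RPrec f g) (0 :: xs) z
| reval_precS f g n xs y z :
    reval (RPrec f g) (n :: xs) y -> reval g (n :: y :: xs) z ->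
    reval (RPrec f g) (S n :: xs) z
| reval_mu f xs y :
    reval f (y :: xs) 0 ->
    (forall i, i < y -> exists v, reval f (i :: xs) (S v)) ->
    reval (RMu f) xs y.

Definition cpair (x y : nat) : nat := (x + y) * (x + y + 1) / 2 + x.

Fixpoint godel (f : recfun) : nat :=
  match f with
  | RZero => cpair 0 0
  | RSucc => cpair 1 0
  | RProj i => cpair 2 i
  | RComp f gs =>
      cpair 3 (cpair (godel f) (fold_right (fun g n => S (cpair (godel g) n)) 0 gs))
  | RPrec f g => cpair 4 (cpair (godel f) (godel g))
  | RMu f => cpair 5 (godel f)
  end.

(** [{x}(y) = z] *)
Definition kleene (x y z : nat) : Prop :=
  exists f, godel f = x /\ reval f [y] z.

(** * The formulas G and B

    [G] and the formulas from which [B] is built are parameters of everything that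
    follows, specified by the properties below. *)

Record is_G (G : pform) : Prop := {
  G_sigma : sigma G;
  G_fv : fv_below 3 G;
  G_defines : forall (e : nat -> nat) x y z,
    sat (scons x (scons y (scons z e))) (circ G) <-> kleene x y z;
  G_functional :
    HA (circ (all4 (fun x y z1 z2 =>
          papp G [x; y; z1] ∧ papp G [x; y; z2] ⇒ pE z1 z2)))
}.

(** [HA] proves that [F] (last argument: the value) is the graph of a
    total function of one, resp. two, arguments. *)
Record function1 (F : pform) : Prop := {
  function1_sigma : sigma F;
  function1_fv : fv_below 2 F;
  function1_total : HA (circ (All (Ex (papp F [1; 0]))));
  function1_unique :
    HA (circ (all3 (fun x y1 y2 => papp F [x; y1] ∧ papp F [x; y2] ⇒ pE y1 y2)))
}.

Record function2 (F : pform) : Prop := {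
  function2_sigma : sigma F;
  function2_fv : fv_below 3 F;
  function2_total : HA (circ (All (All (Ex (papp F [2; 1; 0])))));
  function2_unique :
    HA (circ (all4 (fun x y z1 z2 =>
          papp F [x; y; z1] ∧ papp F [x; y; z2] ⇒ pE z1 z2)))
}.

(** [c(y,z) = x], cleared of the division by 2. *)
Definition pair_eq (y z x : nat) : aform :=
  let y := Var y in let z := Var z in let x := Var x in
  Plus (Mult (Plus y z) (Succ (Plus y z))) (Plus y y) ≈ Plus x x.

(** [Fl], [Fr], [Fs] provably represent in [HA] the projections [l], [r] and the
    function [l_*], which are given by [c(l(x),r(x)) = x], [l_*(x,0) = x] and
    [l_*(x,y+1) = l(l_*(x,y))]. *)
Record represents (Fl Fr Fs : pform) : Prop := {
  l_function : function1 Fl;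
  r_function : function1 Fr;
  ls_function : function2 Fs;
  l_r_pair :
    HA (all3 (fun x y z =>
          circ (papp Fl [x; y] ∧ papp Fr [x; z]) ⇒ pair_eq y z x));
  ls_zero :
    HA (circ (all2 (fun x y => pZ y ⇒ papp Fs [x; y; x])));
  ls_succ :
    HA (circ (all5 (fun x y y' z w =>
          pS y y' ∧ papp Fs [x; y; z] ∧ papp Fl [z; w] ⇒ papp Fs [x; y'; w])))
}.

Definition B_form (Fr Fs : pform) : pform :=
  (* [r(l_*(u,v)) = s0]; under the quantifiers [u, v] are 3, 4 *)
  let u := 3 in let v := 4 in let w := 2 in let zero := 1 in let one := 0 in
  Ex (Ex (Ex (pZ zero ∧ pS zero one ∧ papp Fs [u; v; w] ∧ papp Fr [w; one]))).

(** * The formulas Q, M, nCT* *)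

Definition H_form (G : pform) (x y : nat) : pform :=
  Ex (pZ 0 ∧ papp G [S x; S y; 0]).

Definition Q_form (G Fr Fs : pform) : pform :=
  bigand
    (all3 (fun x y z => pS x z ∧ pS y z ⇒ pE x y))
  [ all2 (fun x y => pS x y ⇒ ¬ pZ y);
    all3 (fun x y z => pE x y ∧ pE x z ⇒ pE y z);
    all3 (fun x y z => pE x y ∧ pS x z ⇒ pS y z);
    all2 (fun x y => pZ y ⇒ pA x y x);
    all5 (fun x y z u v => pS y z ∧ pA x y u ∧ pS u v ⇒ pA x z v);
    all2 (fun x y => pZ y ⇒ pM x y y);
    all5 (fun x y z u v => pS y z ∧ pM x y u ∧ pA u x v ⇒ pM x z v);
    all4 (fun x1 x2 y z => pE x1 x2 ∧ pA x1 y z ⇒ pA x2 y z);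
    all4 (fun x y1 y2 z => pE y1 y2 ∧ pA x y1 z ⇒ pA x y2 z);
    all4 (fun x1 x2 y z => pE x1 x2 ∧ pM x1 y z ⇒ pM x2 y z);
    all4 (fun x y1 y2 z => pE y1 y2 ∧ pM x y1 z ⇒ pM x y2 z);
    All (pZ 0 ∨ Ex (pS 0 1));
    Ex (pZ 0);
    all2 (fun x y => pZ x ∧ pZ y ⇒ pE x y);
    all2 (fun x y => pE x y ∧ pZ x ⇒ pZ y);
    All (Ex (pS 1 0));
    all3 (fun x y z => pS x y ∧ pS x z ⇒ pE y z);
    all3 (fun x y z => pS x y ∧ pE y z ⇒ pS x z);
    All (All (Ex (pA 2 1 0)));
    all4 (fun x y z1 z2 => pA x y z1 ∧ pA x y z2 ⇒ pE z1 z2);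
    all4 (fun x y z1 z2 => pA x y z1 ∧ pE z1 z2 ⇒ pA x y z2);
    All (All (Ex (pM 2 1 0)));
    all4 (fun x y z1 z2 => pM x y z1 ∧ pM x y z2 ⇒ pE z1 z2);
    all4 (fun x y z1 z2 => pM x y z1 ∧ pE z1 z2 ⇒ pM x y z2);
    all4 (fun x y z1 z2 => papp G [x; y; z1] ∧ papp G [x; y; z2] ⇒ pE z1 z2);
    (let y := 3 in let z := 2 in let v := 1 in let x := 0 in
     All (All (¬ ¬ Ex (All (ple x z ⇒ (papp (B_form Fr Fs) [v; x] ⇔ H_form G y x))))));
    all2 (fun x y => papp (B_form Fr Fs) [x; y] ∨ ¬ papp (B_form Fr Fs) [x; y]) ].

Definition EqPR : pform :=
  all2 (fun x y => pE x y ⇒ (pP x ⇒ pP y))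
  ∧ all4 (fun x1 x2 y1 y2 => pE x1 y1 ∧ pE x2 y2 ⇒ (pR x1 x2 ⇒ pR y1 y2)).

Definition Markov : pform :=
  All (pP 0 ∨ ¬ pP 0) ∧ ¬ ¬ Ex (pP 0) ⇒ Ex (pP 0).

Definition nCT (G : pform) : pform :=
  All (¬ pP 0 ⇒ Ex (pR 1 0))
  ⇒ Ex (All (¬ pP 0 ⇒ Ex (papp G [2; 1; 0] ∧ pR 1 0))).

Definition nCT_star (G Fr Fs : pform) : pform :=
  Q_form G Fr Fs ∧ EqPR ⇒ nCT G.

(** * The theories CA and MA *)

(** The axioms of [MQC] in the language [LA]. *)
Inductive MQC_ax (G Fr Fs : pform) : aform -> Prop :=
| MQC_Markov Psi : MQC_ax G Fr Fs (instance Psi 0 Markov)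
| MQC_nCT_star Psi : MQC_ax G Fr Fs (instance Psi 0 (nCT_star G Fr Fs)).

Definition CA (G Fr Fs : pform) : aform -> Prop :=
  deducible (fun A => HA_ax A \/ MQC_ax G Fr Fs A).

(** In [MA_Markov], index 0 of [Phi] is [x].  In [MA_ECT], index 0 of [Phi] is
    [x], and indices 1, 0 of [Psi] are [x, y]; the renamings make room for the
    quantifier on [z]. *)
Inductive MA_ax (G : pform) : aform -> Prop :=
| MA_Markov Phi :
    MA_ax G (All (Phi ∨ ¬ Phi) ∧ ¬ ¬ Ex Phi ⇒ Ex Phi)
| MA_ECT Phi Psi :
    let Phi' :=
      asubst (fun n => match n with 0 => Var 0 | S m => Var (S (S m)) end) Phi in
    let Psi' :=
      asubst (fun n => match n with
                       | 0 => Var 0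
                       | 1 => Var 1
                       | S (S m) => Var (S (S (S m)))
                       end) Psi in
    MA_ax G (All (¬ Phi ⇒ Ex Psi)
             ⇒ Ex (All (¬ Phi' ⇒ Ex (circ (papp G [2; 1; 0]) ∧ Psi')))).

Definition MA (G : pform) : aform -> Prop :=
  deducible (fun A => HA_ax A \/ MA_ax G A).

(* Main.v *)
Require Import Defs.
From Stdlib Require Import List Arith Lia Setoid Morphisms Ring.
Import ListNotations.
Local Open Scope form_scope.

(** The axiom [MA_ECT] for [Phi] and [Psi] is the conclusion of the instance of
    [nCT*] that reads [Z, E, S, A, M] arithmetically, [P] as [Phi] and [R] as
    [Psi] ([reading_nCT]); the Markov axioms are instances of [Markov].  So it is
    enough that HA proves the premises of that instance.  The equality axioms
    [EqPR] are cases of the congruence of equality ([EqPR_true]).  The formula [Q]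
    contains no predicate variables but [Z, E, S, A, M], because [G], [Fr] and [Fs]
    are Sigma-formulas, so its instance is its arithmetical reading, which is shown
    to be a theorem of HA ([Q_true]).

    All conjuncts of [Q] except the last two are elementary, or hold by the choice
    of [G].  The formula [B(u,v)] says that the [v]-th component of the sequence [u]
    is 1.  It is decidable because its components are values of provably total
    functions and equality with 1 is decidable ([bit_decidable]).  The remaining
    conjunct says that an initial segment of a predicate [H] is, up to a double
    negation, given by some sequence.  The pairing function only allows to
    put a new component in front of a sequence: if [u' = c(u,a)], then component 0
    of [u'] is [a] and component [y+1] of [u'] is component [y] of [u].  Hence the
    induction on the length [z] of the segment is carried out for all the shifted
    predicates [H(x+k)] at once ([comprehension]): a code of [H(x+k+1)] for [x < z]
    is extended by a bit that decides [H(k)], and since the goal is a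
    contradiction, [H(k)] may be assumed to be decided.

    HA is a formal system here, and these arguments have to be carried out in it.
    This is done with a forcing relation whose worlds are the contexts, with terms
    as individuals.  Forcing a formula is equivalent to deriving it
    ([force_prv]), but it unfolds the connectives into those of the metalanguage,
    with universal quantification over terms instead of eigenvariables.  Proofs in
    HA thus become ordinary proofs about terms; induction on numbers is induction
    on a term for a statement that some formula expresses ([force_ind]). *)

(** * Substitution *)

Lemma tsubst_ext s r t : (forall n, s n = r n) -> tsubst s t = tsubst r t.
Proof. intros E; induction t; cbn; congruence. Qed.

Lemma tsubst_comp s r t :
  tsubst s (tsubst r t) = tsubst (fun n => tsubst s (r n)) t.
Proof. induction t; cbn; congruence. Qed.

Lemma tsubst_id s t : (forall n, s n = Var n) -> tsubst s t = t.
Proof. intros E; induction t; cbn; congruence. Qed.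

Lemma up_ext s r : (forall n, s n = r n) -> forall n, up s n = up r n.
Proof. intros E [|n]; cbn; [reflexivity | now rewrite E]. Qed.

Lemma asubst_ext A : forall s r, (forall n, s n = r n) -> asubst s A = asubst r A.
Proof.
  induction A as [[t u]| | | | | |]; intros s r E; cbn; f_equal;
    auto using up_ext.
  now rewrite (tsubst_ext s r t), (tsubst_ext s r u).
Qed.

Lemma up_comp s r n : tsubst (up s) (up r n) = up (fun m => tsubst s (r m)) n.
Proof.
  destruct n; cbn; [reflexivity|].
  unfold tshift; rewrite !tsubst_comp; reflexivity.
Qed.

Lemma asubst_comp A :
  forall s r, asubst s (asubst r A) = asubst (fun n => tsubst s (r n)) A.
Proof.
  induction A as [[t u]| | | | | |]; intros s r; cbn; f_equal; auto.
  - now rewrite !tsubst_comp.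
  - rewrite IHA; apply asubst_ext, up_comp.
  - rewrite IHA; apply asubst_ext, up_comp.
Qed.

Lemma asubst_id A : forall s, (forall n, s n = Var n) -> asubst s A = A.
Proof.
  induction A as [[t u]| | | | | |]; intros s E; cbn; f_equal; auto.
  - now rewrite !tsubst_id.
  - apply IHA; intros [|n]; cbn; [|rewrite E]; reflexivity.
  - apply IHA; intros [|n]; cbn; [|rewrite E]; reflexivity.
Qed.

Definition tcons (t : term) (σ : nat -> term) (n : nat) : term :=
  match n with 0 => t | S m => σ m end.

Lemma inst1_up A σ t : inst1 (asubst (up σ) A) t = asubst (tcons t σ) A.
Proof.
  unfold inst1; rewrite asubst_comp; apply asubst_ext.
  intros [|n]; cbn; [reflexivity|].
  unfold tshift; rewrite tsubst_comp; now apply tsubst_id.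
Qed.

Lemma asubst_inst1 s A t : asubst s (inst1 A t) = inst1 (asubst (up s) A) (tsubst s t).
Proof.
  rewrite inst1_up; unfold inst1; rewrite asubst_comp; apply asubst_ext.
  now intros [|n].
Qed.

Lemma asubst_ashift s A : asubst (up s) (ashift A) = ashift (asubst s A).
Proof. unfold ashift; rewrite !asubst_comp; now apply asubst_ext. Qed.

Lemma map_asubst_ashift s G :
  map (asubst (up s)) (map ashift G) = map ashift (map (asubst s) G).
Proof. rewrite !map_map; apply map_ext; intros A; apply asubst_ashift. Qed.

(** * Structural properties of the calculus *)

Lemma prv_weaken T G D A : prv T G A -> incl G D -> prv T D A.
Proof.
  intros H; revert D; induction H; intros D I;
    try solve [econstructor; eauto using incl_map].
  - apply prv_orE with A B; auto; [apply IHprv2|apply IHprv3];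
      now apply incl_cons; [left|apply incl_tl].
  - apply prv_impI, IHprv; now apply incl_cons; [left|apply incl_tl].
  - apply prv_exE with A; auto.
    apply IHprv2; apply incl_cons; [now left|]; now apply incl_tl, incl_map.
Qed.

(** Theories are compared by deriving the axioms of one in the other. *)
Lemma prv_axioms (T U : aform -> Prop) :
  (forall A, T A -> prv U [] A) -> forall G A, prv T G A -> prv U G A.
Proof.
  intros TU G A H; induction H; try solve [econstructor; eauto].
  apply prv_weaken with []; [now apply TU | intros ? []].
Qed.

Lemma HA_ax_subst A : HA_ax A -> forall s, HA_ax (asubst s A).
Proof.
  intros [] s; cbn; try constructor.
  - rewrite !asubst_inst1; constructor.
  - rewrite asubst_inst1.
    replace (asubst (up s) step)
      with (asubst (fun n => match n with 0 => Succ (Var 0) | S m => Var (S m) end)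
              (asubst (up s) A0)); [apply HA_ind|].
    unfold step; rewrite !asubst_comp; apply asubst_ext.
    intros [|n]; cbn; [reflexivity|].
    unfold tshift; now rewrite tsubst_comp.
Qed.

(** Derivations are closed under substitution because the axioms are, all of them
    being schemes with parameters. *)
Lemma prv_subst G A : prv HA_ax G A ->
  forall s, prv HA_ax (map (asubst s) G) (asubst s A).
Proof.
  intros H; induction H; intros s; cbn in *;
    try solve [econstructor; eauto using HA_ax_subst, in_map].
  - apply prv_allI; rewrite <- map_asubst_ashift; apply IHprv.
  - rewrite asubst_inst1; apply prv_allE, IHprv.
  - apply prv_exI with (tsubst s t); rewrite <- asubst_inst1; apply IHprv.
  - apply prv_exE with (asubst (up s) A); [apply IHprv1|].
    rewrite <- asubst_ashift, <- map_asubst_ashift; apply IHprv2.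
Qed.

(** * Fresh variables *)

(** A semantic rendering of having all free variables below [n]; it is all that
    freshness of a variable is needed for. *)
Definition bounded (n : nat) (A : aform) : Prop :=
  forall s r, (forall i, i < n -> s i = r i) -> asubst s A = asubst r A.

Lemma tsubst_bounded t :
  exists n, forall s r, (forall i, i < n -> s i = r i) -> tsubst s t = tsubst r t.
Proof.
  induction t as [k| |t [n Hn]|t [n Hn] u [m Hm]|t [n Hn] u [m Hm]]; cbn.
  - exists (S k); intros s r E; apply E; lia.
  - now exists 0.
  - exists n; intros s r E; f_equal; now apply Hn.
  - exists (n + m); intros s r E.
    rewrite (Hn s r), (Hm s r) by (intros; apply E; lia); reflexivity.
  - exists (n + m); intros s r E.
    rewrite (Hn s r), (Hm s r) by (intros; apply E; lia); reflexivity.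
Qed.

Lemma bounded_exists A : exists n, bounded n A.
Proof.
  assert (bin : forall n m s r, (forall i, i < n + m -> s i = r i :> term) ->
                  (forall i, i < n -> s i = r i) /\ (forall i, i < m -> s i = r i))
    by (intros n m s r E; split; intros; apply E; lia).
  assert (under : forall n s r, (forall i, i < n -> s i = r i) ->
                  forall i, i < n -> up s i = up r i)
    by (intros n s r E [|i] L; cbn; [|rewrite E by lia]; reflexivity).
  induction A as [[t u]| |A [n Hn] B [m Hm]|A [n Hn] B [m Hm]|A [n Hn] B [m Hm]
                 |A [n Hn]|A [n Hn]].
  - destruct (tsubst_bounded t) as [n Hn], (tsubst_bounded u) as [m Hm].
    exists (n + m); intros s r [E1 E2]%bin; cbn.
    now rewrite (Hn s r), (Hm s r).
  - now exists 0.
  - exists (n + m); intros s r [E1 E2]%bin; cbn; f_equal; auto.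
  - exists (n + m); intros s r [E1 E2]%bin; cbn; f_equal; auto.
  - exists (n + m); intros s r [E1 E2]%bin; cbn; f_equal; auto.
  - exists n; intros s r E; cbn; f_equal; now apply Hn, under.
  - exists n; intros s r E; cbn; f_equal; now apply Hn, under.
Qed.

Lemma bounded_le n m A : bounded n A -> n <= m -> bounded m A.
Proof. intros H L s r E; apply H; intros; apply E; lia. Qed.

Lemma bounded_list G : exists n, Forall (bounded n) G.
Proof.
  induction G as [|A G [n Hn]]; [now exists 0|].
  destruct (bounded_exists A) as [m Hm].
  exists (n + m); constructor; [apply bounded_le with m; auto; lia|].
  apply Forall_impl with (2 := Hn); intros B HB.
  apply bounded_le with n; auto; lia.
Qed.

(** Turns the variable [k] into the one bound by a new innermost quantifier. *)
Definition bind (k n : nat) : term := if n =? k then Var 0 else Var (S n).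

Lemma bind_fresh k A : bounded k A -> asubst (bind k) A = ashift A.
Proof.
  intros H; apply H; intros i L; unfold bind.
  now replace (i =? k) with false by (symmetry; apply Nat.eqb_neq; lia).
Qed.

Lemma bind_inst1 k A : bounded k (All A) -> asubst (bind k) (inst1 A (Var k)) = A.
Proof.
  intros H.
  assert (E : asubst (bind k) (All A) = ashift (All A)) by now apply bind_fresh.
  injection E as E; rewrite asubst_inst1, E.
  unfold inst1; rewrite asubst_comp; apply asubst_id.
  intros [|n]; cbn; [unfold bind; now rewrite Nat.eqb_refl | reflexivity].
Qed.

Lemma map_bind_fresh k G : Forall (bounded k) G -> map (asubst (bind k)) G = map ashift G.
Proof. intros H; apply map_ext_Forall, Forall_impl with (2 := H), bind_fresh. Qed.

(** The premise covers the case that [t] is a variable that occurs nowhere, which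
    is an eigenvariable once it is bound.  The premise of [prv_ex_terms] is used in
    the same way. *)
Lemma prv_all_terms G A :
  (forall t, prv HA_ax G (inst1 A t)) -> prv HA_ax G (All A).
Proof.
  intros H; destruct (bounded_list (All A :: G)) as [k Hk].
  inversion Hk as [|? ? HA HG]; subst.
  apply prv_allI; rewrite <- (map_bind_fresh k), <- (bind_inst1 k A); auto.
  now apply prv_subst.
Qed.

Lemma prv_ex_terms G A C :
  prv HA_ax G (Ex A) ->
  (forall t, prv HA_ax (inst1 A t :: G) C) -> prv HA_ax G C.
Proof.
  intros HE H; destruct (bounded_list (All A :: C :: G)) as [k Hk].
  inversion Hk as [|? ? HA Hk']; subst; inversion Hk' as [|? ? HC HG]; subst.
  apply prv_exE with A; auto.
  rewrite <- (map_bind_fresh k), <- (bind_inst1 k A) at 1; auto.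
  rewrite <- (bind_fresh k C) by auto.
  apply (prv_subst _ _ (H (Var k)) (bind k)).
Qed.

(** * Forcing over contexts *)

Notation "G ⊢ A" := (prv HA_ax G A%form) (at level 72, no associativity).

Definition eqn (G : list aform) (t u : term) : Prop := G ⊢ t ≈ u.

(** [P] holds locally at [G]: any formula can be derived as if [P] held.  This is
    the impredicative form of a Beth cover; it makes disjunction and existence agree
    with derivability, since a derivable disjunction need not have a derivable
    disjunct. *)
Definition cov (G : list aform) (P : list aform -> Prop) : Prop :=
  forall D C, incl G D -> (forall E, incl D E -> P E -> E ⊢ C) -> D ⊢ C.

(** [force G σ A] forces [A] at the context [G], where [σ] gives the values of the
    free variables. *)
Fixpoint force (G : list aform) (σ : nat -> term) (A : aform) : Prop :=
  match A with
  | Atom (t, u) => eqn G (tsubst σ t) (tsubst σ u)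
  | Bot => G ⊢ Bot
  | And A B => force G σ A /\ force G σ B
  | Or A B => cov G (fun D => force D σ A \/ force D σ B)
  | Imp A B => forall D, incl G D -> force D σ A -> force D σ B
  | All A => forall t, force G (tcons t σ) A
  | Ex A => cov G (fun D => exists t, force D (tcons t σ) A)
  end.

(** Soundness and completeness of forcing for derivability.  The hypothesis of an
    implication is met by adding it to the context, and the quantifier rules are
    those of [prv_all_terms] and [prv_ex_terms]. *)
Lemma force_prv A : forall G σ, force G σ A <-> G ⊢ asubst σ A.
Proof.
  assert (hd : forall B G, B :: G ⊢ B) by (intros; apply prv_hyp; now left).
  induction A as [[t u]| |A IA B IB|A IA B IB|A IA B IB|A IA|A IA]; intros G σ; cbn.
  - reflexivity.
  - reflexivity.
  - rewrite IA, IB; split; [intros []; now apply prv_andI|].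
    intros H; split; [apply prv_andE1 in H | apply prv_andE2 in H]; assumption.
  - split.
    + intros H; apply H; [apply incl_refl|].
      intros E _ [HA|HB]; [apply prv_orI1, IA, HA | apply prv_orI2, IB, HB].
    + intros H D C I K; apply prv_orE with (asubst σ A) (asubst σ B);
        [now apply prv_weaken with G| |]; apply K; try (now apply incl_tl, incl_refl);
        [left; apply IA | right; apply IB]; apply hd.
  - split.
    + intros H; apply prv_impI, IB, H; [now apply incl_tl, incl_refl | apply IA, hd].
    + intros H D I HA; apply IB; apply prv_impE with (asubst σ A);
        [now apply prv_weaken with G | now apply IA].
  - split.
    + intros H; apply prv_all_terms; intros t; rewrite inst1_up; apply IA, H.
    + intros H t; apply IA; rewrite <- inst1_up; now apply prv_allE.
  - split.
    + intros H; apply H; [apply incl_refl|].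
      intros E _ [t HA]; apply prv_exI with t; rewrite inst1_up; now apply IA.
    + intros H D C I K; apply prv_ex_terms with (asubst (up σ) A);
        [now apply prv_weaken with G|].
      intros t; rewrite inst1_up; apply K; [now apply incl_tl, incl_refl|].
      exists t; apply IA, hd.
Qed.

Lemma force_mono A G D σ : force G σ A -> incl G D -> force D σ A.
Proof. rewrite !force_prv; apply prv_weaken. Qed.

Lemma cov_mono P G D : cov G P -> incl G D -> cov D P.
Proof. intros H I E C J; apply H; eauto using incl_tran. Qed.

(** [cov] is a monad on the monotone predicates of contexts, and everything that is
    forced is an algebra of it ([cov_force]).  This is how local facts are used. *)
Lemma cov_ret (P : list aform -> Prop) G :
  (forall D, incl G D -> P D) -> cov G P.
Proof. intros H D C I K; apply K; [apply incl_refl | now apply H]. Qed.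

Lemma cov_prv P G C : cov G P -> (forall D, incl G D -> P D -> D ⊢ C) -> G ⊢ C.
Proof. intros H K; apply H; [apply incl_refl | exact K]. Qed.

Lemma cov_force P G σ A :
  cov G P -> (forall D, incl G D -> P D -> force D σ A) -> force G σ A.
Proof.
  intros H K; apply force_prv, (cov_prv P); [exact H|].
  intros; now apply force_prv, K.
Qed.

Lemma cov_bind P Q G :
  cov G P -> (forall D, incl G D -> P D -> cov D Q) -> cov G Q.
Proof.
  intros H K D C I L; apply H; [exact I|]; intros E J HP.
  apply (K E (incl_tran I J) HP); [apply incl_refl|].
  intros F M; apply L; eauto using incl_tran.
Qed.

Lemma force_asubst A G σ r : force G σ (asubst r A) <-> force G (fun n => tsubst σ (r n)) A.
Proof. now rewrite !force_prv, asubst_comp. Qed.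

Lemma force_closed A : (forall σ, force [] σ A) -> HA A.
Proof.
  intros H; unfold HA, deducible; rewrite <- (asubst_id A Var) by reflexivity.
  now apply force_prv.
Qed.

Lemma HA_force A G σ : HA A -> force G σ A.
Proof.
  intros H; apply force_mono with []; [|intros ? []].
  now apply force_prv, (prv_subst _ _ H).
Qed.

Lemma force_ext A G σ τ : (forall n, σ n = τ n) -> force G σ A <-> force G τ A.
Proof. intros E; now rewrite !force_prv, (asubst_ext A σ τ E). Qed.

(** * Equality and induction *)

Lemma eqn_mono G D t u : eqn G t u -> incl G D -> eqn D t u.
Proof. apply prv_weaken. Qed.

Lemma eqn_ax G t u : HA_ax (t ≈ u) -> eqn G t u.
Proof. apply prv_ax. Qed.

Lemma eqn_refl G t : eqn G t t.
Proof. apply eqn_ax, HA_refl. Qed.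

Lemma eqn_replace G A σ t u :
  eqn G t u -> force G (tcons t σ) A -> force G (tcons u σ) A.
Proof.
  rewrite !force_prv, <- !inst1_up; intros E H.
  refine (prv_impE _ _ _ _ (prv_impE _ _ _ _ _ E) H); apply prv_ax, HA_leibniz.
Qed.

Lemma eqn_sym G t u : eqn G t u -> eqn G u t.
Proof.
  intros E; apply (eqn_replace G (Var 0 ≈ Var 1) (tcons t Var) t u E), eqn_refl.
Qed.

Lemma eqn_trans G t u v : eqn G t u -> eqn G u v -> eqn G t v.
Proof.
  intros E H; apply (eqn_replace G (Var 1 ≈ Var 0) (tcons t Var) u v H E).
Qed.

#[export] Instance eqn_equivalence G : Equivalence (eqn G).
Proof. split; [exact (eqn_refl G) | exact (eqn_sym G) | exact (eqn_trans G)]. Qed.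

#[export] Instance Succ_proper G : Proper (eqn G ==> eqn G) Succ.
Proof.
  intros t u E; apply (eqn_replace G (Succ (Var 1) ≈ Succ (Var 0)) (tcons t Var) t u E), eqn_refl.
Qed.

#[export] Instance Plus_proper G : Proper (eqn G ==> eqn G ==> eqn G) Plus.
Proof.
  intros t u E t' u' E'; transitivity (Plus t u').
  - apply (eqn_replace G (Plus (Var 1) (Var 2) ≈ Plus (Var 1) (Var 0))
             (tcons t (tcons t' Var)) t' u' E'), eqn_refl.
  - apply (eqn_replace G (Plus (Var 1) (Var 2) ≈ Plus (Var 0) (Var 2))
             (tcons t (tcons u' Var)) t u E), eqn_refl.
Qed.

#[export] Instance Mult_proper G : Proper (eqn G ==> eqn G ==> eqn G) Mult.
Proof.
  intros t u E t' u' E'; transitivity (Mult t u').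
  - apply (eqn_replace G (Mult (Var 1) (Var 2) ≈ Mult (Var 1) (Var 0))
             (tcons t (tcons t' Var)) t' u' E'), eqn_refl.
  - apply (eqn_replace G (Mult (Var 1) (Var 2) ≈ Mult (Var 0) (Var 2))
             (tcons t (tcons u' Var)) t u E), eqn_refl.
Qed.

Lemma tsubst_congr G σ τ t :
  (forall n, eqn G (σ n) (τ n)) -> eqn G (tsubst σ t) (tsubst τ t).
Proof.
  intros E; induction t; cbn; auto using eqn_refl.
  - now apply Succ_proper.
  - now apply Plus_proper.
  - now apply Mult_proper.
Qed.

(** By induction on [A] instead of replacing one variable after the other, since
    [σ] and [τ] may differ at infinitely many variables. *)
Lemma force_congr A : forall G σ τ,
  (forall n, eqn G (σ n) (τ n)) -> force G σ A -> force G τ A.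
Proof.
  induction A as [[t u]| |A IA B IB|A IA B IB|A IA B IB|A IA|A IA];
    intros G σ τ E; cbn.
  - intros H; rewrite <- !(tsubst_congr G σ τ) by exact E; exact H.
  - auto.
  - intros []; eauto.
  - intros H; apply (cov_bind _ _ _ H); intros D I HD; apply cov_ret; intros D' I'.
    assert (E' : forall n, eqn D' (σ n) (τ n)) by eauto using eqn_mono, incl_tran.
    destruct HD; [left|right]; eauto using force_mono.
  - intros H D I HA.
    assert (E' : forall n, eqn D (σ n) (τ n)) by eauto using eqn_mono.
    apply IB with σ, H, IA with τ; auto; intros n; symmetry; apply E'.
  - intros H t; apply IA with (tcons t σ); auto.
    intros [|n]; cbn; [reflexivity | apply E].
  - intros H; apply (cov_bind _ _ _ H); intros D I [t HD]; apply cov_ret; intros D' I'.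
    exists t; apply IA with (tcons t σ); eauto using force_mono.
    intros [|n]; cbn; [reflexivity | eauto using eqn_mono, incl_tran].
Qed.

(** The formula [A] has to express the property of terms that the induction is
    about: HA has no induction for arbitrary predicates of the metalanguage. *)
Lemma force_ind A G σ :
  force G (tcons Zero σ) A ->
  (forall D t, incl G D -> force D (tcons t σ) A -> force D (tcons (Succ t) σ) A) ->
  forall t, force G (tcons t σ) A.
Proof.
  intros H0 HS.
  enough (H : force G σ (All A)) by exact H.
  apply force_prv; cbn.
  eapply prv_impE; [apply prv_ax, HA_ind|]; apply prv_andI.
  - rewrite inst1_up; now apply force_prv.
  - rewrite <- (asubst_id (All _) Var) by reflexivity; apply force_prv; cbn.
    intros t D I; rewrite !force_asubst; intros H.
    apply (force_congr _ _ (tcons (Succ t) σ)).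
    + intros [|n]; cbn; [reflexivity|].
      unfold tshift; rewrite tsubst_comp, tsubst_id by reflexivity; reflexivity.
    + apply HS; [exact I|]; revert H; apply force_congr.
      intros [|n]; cbn; [reflexivity|].
      unfold tshift; rewrite tsubst_comp, tsubst_id by reflexivity; reflexivity.
Qed.

Lemma cov_eqn P G t u :
  cov G P -> (forall D, incl G D -> P D -> eqn D t u) -> eqn G t u.
Proof. apply cov_prv. Qed.

(** * Arithmetic *)

Lemma plus_0_r G t : eqn G (Plus t Zero) t.
Proof. apply eqn_ax, HA_plus0. Qed.

Lemma plus_S_r G t u : eqn G (Plus t (Succ u)) (Succ (Plus t u)).
Proof. apply eqn_ax, HA_plusS. Qed.

Lemma mult_0_r G t : eqn G (Mult t Zero) Zero.
Proof. apply eqn_ax, HA_mult0. Qed.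

Lemma mult_S_r G t u : eqn G (Mult t (Succ u)) (Plus (Mult t u) t).
Proof. apply eqn_ax, HA_multS. Qed.

(** The environment of a formula whose indices [0, 1, ...] stand for the terms [ts]. *)
Definition env (ts : list term) (n : nat) : term := nth n ts Zero.

Lemma eqn_ind G ts l r :
  eqn G (tsubst (tcons Zero (env ts)) l) (tsubst (tcons Zero (env ts)) r) ->
  (forall D t, incl G D ->
     eqn D (tsubst (tcons t (env ts)) l) (tsubst (tcons t (env ts)) r) ->
     eqn D (tsubst (tcons (Succ t) (env ts)) l) (tsubst (tcons (Succ t) (env ts)) r)) ->
  forall t, eqn G (tsubst (tcons t (env ts)) l) (tsubst (tcons t (env ts)) r).
Proof. exact (force_ind (l ≈ r) G (env ts)). Qed.

Lemma plus_0_l G t : eqn G (Plus Zero t) t.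
Proof.
  apply (eqn_ind G [] (Plus Zero (Var 0)) (Var 0)); cbn; [apply plus_0_r|].
  intros D u _ IH; now rewrite plus_S_r, IH.
Qed.

Lemma plus_S_l G t u : eqn G (Plus (Succ t) u) (Succ (Plus t u)).
Proof.
  apply (eqn_ind G [t] (Plus (Succ (Var 1)) (Var 0)) (Succ (Plus (Var 1) (Var 0)))); cbn.
  - now rewrite !plus_0_r.
  - intros D v _ IH; now rewrite !plus_S_r, IH.
Qed.

Lemma plus_comm G t u : eqn G (Plus t u) (Plus u t).
Proof.
  apply (eqn_ind G [t] (Plus (Var 1) (Var 0)) (Plus (Var 0) (Var 1))); cbn.
  - now rewrite plus_0_r, plus_0_l.
  - intros D v _ IH; now rewrite plus_S_r, plus_S_l, IH.
Qed.

Lemma plus_assoc G t u v : eqn G (Plus t (Plus u v)) (Plus (Plus t u) v).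
Proof.
  apply (eqn_ind G [t; u] (Plus (Var 1) (Plus (Var 2) (Var 0)))
           (Plus (Plus (Var 1) (Var 2)) (Var 0))); cbn.
  - now rewrite !plus_0_r.
  - intros D w _ IH; now rewrite !plus_S_r, IH.
Qed.

Lemma mult_0_l G t : eqn G (Mult Zero t) Zero.
Proof.
  apply (eqn_ind G [] (Mult Zero (Var 0)) Zero); cbn; [apply mult_0_r|].
  intros D u _ IH; now rewrite mult_S_r, IH, plus_0_r.
Qed.

Lemma mult_S_l G t u : eqn G (Mult (Succ t) u) (Plus (Mult t u) u).
Proof.
  apply (eqn_ind G [t] (Mult (Succ (Var 1)) (Var 0)) (Plus (Mult (Var 1) (Var 0)) (Var 0)));
    cbn.
  - now rewrite !mult_0_r, plus_0_r.
  - intros D v _ IH; rewrite !mult_S_r, IH, !plus_S_r, <- !plus_assoc.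
    now rewrite (plus_comm D v t).
Qed.

Lemma mult_comm G t u : eqn G (Mult t u) (Mult u t).
Proof.
  apply (eqn_ind G [t] (Mult (Var 1) (Var 0)) (Mult (Var 0) (Var 1))); cbn.
  - now rewrite mult_0_r, mult_0_l.
  - intros D v _ IH; now rewrite mult_S_r, mult_S_l, IH.
Qed.

Lemma mult_plus_l G t u v : eqn G (Mult (Plus t u) v) (Plus (Mult t v) (Mult u v)).
Proof.
  apply (eqn_ind G [t; u] (Mult (Plus (Var 1) (Var 2)) (Var 0))
           (Plus (Mult (Var 1) (Var 0)) (Mult (Var 2) (Var 0)))); cbn.
  - now rewrite !mult_0_r, plus_0_r.
  - intros D w _ IH; rewrite !mult_S_r, IH, <- !plus_assoc.
    now rewrite (plus_assoc D (Mult u w) t), (plus_comm D (Mult u w) t), <- plus_assoc.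
Qed.

Lemma mult_assoc G t u v : eqn G (Mult t (Mult u v)) (Mult (Mult t u) v).
Proof.
  apply (eqn_ind G [t; u] (Mult (Var 1) (Mult (Var 2) (Var 0)))
           (Mult (Mult (Var 1) (Var 2)) (Var 0))); cbn.
  - now rewrite !mult_0_r.
  - intros D w _ IH; rewrite !mult_S_r, <- IH.
    rewrite (mult_comm D t (Plus _ _)), mult_plus_l.
    now rewrite (mult_comm D t (Mult u w)), (mult_comm D t u).
Qed.

(** A constant of its own for the unit: [Succ t] can be rewritten to [t + one]
    without rewriting the unit again. *)
Definition one : term := Succ Zero.

(** Polynomial identities are provable in HA with no hypotheses; the equality of
    the empty context makes the terms a semiring in which they can be computed. *)
Lemma semiring : semi_ring_theory Zero one Plus Mult (eqn []).
Proof.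
  split; intros.
  - apply plus_0_l.
  - apply plus_comm.
  - apply plus_assoc.
  - unfold one; now rewrite mult_S_l, mult_0_l, plus_0_l.
  - apply mult_0_l.
  - apply mult_comm.
  - apply mult_assoc.
  - apply mult_plus_l.
Qed.

Lemma semiring_ext : sring_eq_ext Plus Mult (eqn []).
Proof. split; [apply Plus_proper | apply Mult_proper]. Qed.

Add Ring HA_semiring : semiring (setoid (eqn_equivalence []) semiring_ext).

Lemma Succ_one G t : eqn G (Succ t) (Plus t one).
Proof. unfold one; now rewrite plus_S_r, plus_0_r. Qed.

Opaque one.

(** An identity of semirings needs no hypotheses, hence holds in all contexts. *)
Ltac arith_ring :=
  apply eqn_mono with []; [rewrite ?Succ_one; ring | intros ? []].

Definition rel (G : list aform) (F : pform) (ts : list term) : Prop :=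
  force G (env ts) (circ F).

Lemma rel_mono G D F ts : rel G F ts -> incl G D -> rel D F ts.
Proof. apply force_mono. Qed.

Lemma cov_rel P G F ts :
  cov G P -> (forall D, incl G D -> P D -> rel D F ts) -> rel G F ts.
Proof. apply cov_force. Qed.

(** [c(y,z) = x], as in [pair_eq]. *)
Definition is_pair G y z x : Prop :=
  eqn G (Plus (Mult (Plus y z) (Succ (Plus y z))) (Plus y y)) (Plus x x).

Lemma is_pair_mono G D y z x : is_pair G y z x -> incl G D -> is_pair D y z x.
Proof. apply eqn_mono. Qed.

(** Moves all hypotheses about the context [G] to the larger context [D]. *)
Ltac lift I :=
  lazymatch type of I with incl ?G ?D =>
    repeat match goal with
    | H : eqn G _ _ |- _ => apply (fun h => eqn_mono G D _ _ h I) in H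
    | H : is_pair G _ _ _ |- _ => apply (fun h => is_pair_mono G D _ _ _ h I) in H
    | H : rel G _ _ |- _ => apply (fun h => rel_mono G D _ _ h I) in H
    | H : force G _ _ |- _ => apply (fun h => force_mono _ G D _ h I) in H
    | H : cov G _ |- _ => apply (fun h => cov_mono _ G D h I) in H
    | H : incl _ G |- _ => apply (fun h => incl_tran h I) in H
    end
  end.

(** What holds at every larger context holds locally. *)
Tactic Notation "locally" := 
  apply cov_ret; let D := fresh "D" in let I := fresh "I" in intros D I; lift I.

(** Uses a [cov] hypothesis for a goal that holds as soon as it holds locally. *)
Tactic Notation "locally" constr(H) "as" simple_intropattern(p) :=
  first [ apply (cov_eqn _ _ _ _ H) | apply (cov_rel _ _ _ _ H)
        | apply (cov_prv _ _ _ H) | apply (cov_force _ _ _ _ H) | apply (cov_bind _ _ _ H) ];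
  let D := fresh "D" in let I := fresh "I" in intros D I; lift I; intros p.

Lemma succ_zero_absurd G t : eqn G (Succ t) Zero -> G ⊢ Bot.
Proof. intros H; refine (prv_impE _ _ _ _ _ H); apply prv_ax, HA_succ_neq. Qed.

Lemma succ_inj G t u : eqn G (Succ t) (Succ u) -> eqn G t u.
Proof. intros H; refine (prv_impE _ _ _ _ _ H); apply prv_ax, HA_succ_inj. Qed.

Lemma zero_or_succ G t : cov G (fun D => eqn D t Zero \/ exists u, eqn D t (Succ u)).
Proof.
  assert (H : force G (tcons t (env [])) (Var 0 ≈ Zero ∨ Ex (Var 1 ≈ Succ (Var 0)))).
  - apply force_ind; cbn.
    + locally; left; reflexivity.
    + intros D u _ _; locally; right; locally; exists u; reflexivity.
  - locally H as [E|E]; [locally; now left|].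
    locally E as [u E']; locally; right; now exists u.
Qed.

Lemma plus_cancel G k t u : eqn G (Plus k t) (Plus k u) -> eqn G t u.
Proof.
  intros H.
  enough (K : force G (tcons k (env [t; u]))
                (Plus (Var 0) (Var 1) ≈ Plus (Var 0) (Var 2) ⇒ Var 1 ≈ Var 2))
    by exact (K G (incl_refl _) H).
  clear H; apply force_ind; cbn.
  - intros D _ H; now rewrite !plus_0_l in H.
  - intros D v _ IH E I H; apply (IH E I), succ_inj; now rewrite <- !plus_S_l.
Qed.

Lemma plus_eq_zero G t u : eqn G (Plus t u) Zero -> eqn G u Zero.
Proof.
  intros H; locally (zero_or_succ G u) as [E|[v E]]; [exact E|].
  apply prv_botE, (succ_zero_absurd _ (Plus t v)); now rewrite <- plus_S_r, <- E.
Qed.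

Lemma le_total G t u :
  cov G (fun D => exists d, eqn D (Plus t d) u \/ eqn D (Plus u d) t).
Proof.
  assert (H : force G (tcons u (env [t]))
     (Ex (Plus (Var 2) (Var 0) ≈ Var 1 ∨ Plus (Var 1) (Var 0) ≈ Var 2))).
  - apply force_ind; cbn.
    + locally; exists t; locally; right; apply plus_0_l.
    + intros D v _ IH; locally IH as [d Hd]; locally Hd as [K|K].
      * locally; exists (Succ d); locally; left; now rewrite plus_S_r, K.
      * locally (zero_or_succ D1 d) as [Z|[e Z]].
        -- locally; exists one; locally; left; rewrite <- K, Z; arith_ring.
        -- locally; exists e; locally; right; rewrite <- K, Z; arith_ring.
  - locally H as [d Hd]; locally Hd as [K|K]; locally; exists d; auto.
Qed.

Lemma double_inj G t u : eqn G (Plus t t) (Plus u u) -> eqn G t u.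
Proof.
  assert (aux : forall D a b d, eqn D (Plus a a) (Plus b b) -> eqn D (Plus a d) b ->
                  eqn D a b).
  { intros D a b d H K; rewrite <- K.
    enough (Z : eqn D d Zero) by now rewrite Z, plus_0_r.
    apply plus_eq_zero with d, plus_cancel with (Plus a a).
    rewrite plus_0_r; transitivity (Plus b b); [rewrite <- K; arith_ring | now symmetry]. }
  intros H; locally (le_total G t u) as [d [K|K]]; [|symmetry]; apply aux with d;
    auto; now symmetry.
Qed.

(** * The pairing function *)

(** The division by 2 in the pairing function is exact. *)
Lemma even_product G s : cov G (fun D => exists q, eqn D (Mult s (Succ s)) (Plus q q)).
Proof.
  apply (force_ind (Ex (Mult (Var 1) (Succ (Var 1)) ≈ Plus (Var 0) (Var 0))) G (env []));
    cbn.
  - locally; exists Zero; now rewrite mult_0_l, plus_0_r.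
  - intros D t _ IH; locally IH as [q Hq]; locally; exists (Plus q (Succ t)).
    transitivity (Plus (Mult t (Succ t)) (Plus (Succ t) (Succ t))); [arith_ring|].
    rewrite Hq; arith_ring.
Qed.

Lemma pair_exists G y z : cov G (fun D => exists x, is_pair D y z x).
Proof.
  locally (even_product G (Plus y z)) as [q Hq]; locally; exists (Plus q y).
  unfold is_pair; rewrite Hq; arith_ring.
Qed.

(** With [s = y + z], the code doubled is [s(s+1) + 2y], which is less than
    [(s+1)(s+2)], hence less than the doubled code of any pair with a larger sum. *)
Lemma pair_sum_not_less G y z y' z' x d :
  is_pair G y z x -> is_pair G y' z' x -> eqn G (Plus (Plus y z) (Succ d)) (Plus y' z') ->
  G ⊢ Bot.
Proof.
  unfold is_pair; intros H H' E; rewrite <- H, <- E in H'.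
  (* The difference of the doubled codes is a successor. *)
  apply (succ_zero_absurd _
    (Plus (Plus z z) (Plus (Plus (Mult (Plus y z) d) (Mult (Plus y z) d))
      (Plus (Plus d (Mult (Succ d) (Succ d))) (Plus y' y'))))).
  apply plus_cancel with (Plus (Mult (Plus y z) (Succ (Plus y z))) (Plus y y)).
  rewrite plus_0_r; etransitivity; [|exact H']; arith_ring.
Qed.

Lemma pair_sum G y z y' z' x :
  is_pair G y z x -> is_pair G y' z' x -> eqn G (Plus y z) (Plus y' z').
Proof.
  intros H H'; locally (le_total G (Plus y z) (Plus y' z')) as [d [K|K]];
    locally (zero_or_succ D d) as [Z|[e Z]]; rewrite Z in K.
  - now rewrite plus_0_r in K.
  - apply prv_botE; now apply (pair_sum_not_less _ y z y' z' x e).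
  - rewrite plus_0_r in K; now symmetry.
  - apply prv_botE; now apply (pair_sum_not_less _ y' z' y z x e).
Qed.

Lemma pair_inj_l G y z y' z' x :
  is_pair G y z x -> is_pair G y' z' x -> eqn G y y'.
Proof.
  intros H H'; assert (E := pair_sum _ _ _ _ _ _ H H'); unfold is_pair in H, H'.
  apply double_inj, plus_cancel with (Mult (Plus y' z') (Succ (Plus y' z'))).
  now rewrite H', <- E.
Qed.

Lemma pair_inj_r G y z y' z' x :
  is_pair G y z x -> is_pair G y' z' x -> eqn G z z'.
Proof.
  intros H H'; assert (E := pair_sum _ _ _ _ _ _ H H').
  rewrite (pair_inj_l _ _ _ _ _ _ H H') in E; now apply plus_cancel in E.
Qed.

(** * Defined relations *)

Arguments papp : simpl never.

(** The depth shifts the parameters of the substituted formulas, and [arith] has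
    none; hence [d] and [e] may differ. *)
Lemma instance_prename A : forall d e r,
  instance arith d (prename r A) = asubst (fun n => Var (r n)) (instance arith e A).
Proof.
  assert (under : forall r n, Var (upr r n) = up (fun m => Var (r m)) n)
    by now intros r [|n].
  induction A as [[i args]| | | | |A IA|A IA]; intros d e r; cbn;
    [destruct i as [|[|i]], args as [|x [|y [|z [|w args]]]]; reflexivity|..];
    f_equal; eauto.
  - rewrite (IA (S d) (S e)); apply asubst_ext, under.
  - rewrite (IA (S d) (S e)); apply asubst_ext, under.
Qed.

Lemma fv_below_bounded A : forall n d, fv_below n A -> bounded n (instance arith d A).
Proof.
  assert (under : forall n s r, (forall i, i < n -> s i = r i) ->
                  forall i, i < S n -> up s i = up r i)
    by (intros n s r E [|i] L; cbn; [|rewrite E by lia]; reflexivity).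
  induction A as [[i args]| |A IA B IB|A IA B IB|A IA B IB|A IA|A IA];
    intros n d H s r E; cbn in *.
  - rewrite Forall_forall in H.
    destruct i as [|[|i]], args as [|x [|y [|z [|w args]]]]; cbn;
      rewrite ?E by (apply H; cbn; auto); reflexivity.
  - reflexivity.
  - destruct H; f_equal; [apply (IA n d)|apply (IB n d)]; auto.
  - destruct H; f_equal; [apply (IA n d)|apply (IB n d)]; auto.
  - destruct H; f_equal; [apply (IA n d)|apply (IB n d)]; auto.
  - f_equal; apply (IA (S n) (S d)); eauto.
  - f_equal; apply (IA (S n) (S d)); eauto.
Qed.

Lemma force_bounded n A G σ τ :
  bounded n A -> (forall i, i < n -> σ i = τ i) -> force G σ A <-> force G τ A.
Proof. intros H E; now rewrite !force_prv, (H σ τ E). Qed.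

Lemma force_papp F args G σ d : fv_below (length args) F ->
  force G σ (instance arith d (papp F args)) <-> rel G F (map σ args).
Proof.
  intros H; unfold papp, rel; rewrite (instance_prename _ d 0), force_asubst.
  apply force_bounded with (length args); [now apply fv_below_bounded|].
  intros i L; cbn; unfold env.
  rewrite nth_indep with (d' := σ 0) by now rewrite length_map.
  symmetry; apply map_nth.
Qed.

(** Unlike [papp], [app] has arbitrary terms as arguments; it serves to write down
    the formulas for [force_ind]. *)
Definition app (F : pform) (ts : list term) : aform := asubst (env ts) (circ F).
Arguments app : simpl never.

Lemma force_app F ts G σ : fv_below (length ts) F ->
  force G σ (app F ts) <-> rel G F (map (tsubst σ) ts).
Proof.
  intros H; unfold app, rel; rewrite force_asubst.
  apply force_bounded with (length ts); [now apply fv_below_bounded|].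
  intros i L; unfold env.
  symmetry; apply (map_nth (tsubst σ) ts Zero).
Qed.

Lemma rel_congr G F ts us : Forall2 (eqn G) ts us -> rel G F ts -> rel G F us.
Proof.
  intros H; apply force_congr; induction H; intros [|n]; cbn; auto; try reflexivity.
  apply IHForall2.
Qed.

Lemma rel_congr2 G F t u t' u' :
  eqn G t t' -> eqn G u u' -> rel G F [t; u] -> rel G F [t'; u'].
Proof. intros E E'; apply rel_congr; auto. Qed.

Lemma fv_below_prename A : forall n m r,
  fv_below n A -> (forall i, i < n -> r i < m) -> fv_below m (prename r A).
Proof.
  assert (under : forall n m r, (forall i, i < n -> r i < m) ->
                  forall i, i < S n -> upr r i < S m)
    by (intros n m r H [|i] L; cbn; [lia|]; specialize (H i); lia).
  induction A as [[i args]| | | | | |]; intros n m r H L; cbn in *;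
    try (destruct H; split); eauto.
  apply Forall_map, Forall_impl with (2 := H), L.
Qed.

Lemma fv_below_papp F args m :
  fv_below (length args) F -> Forall (fun v => v < m) args -> fv_below m (papp F args).
Proof.
  intros H K; apply fv_below_prename with (1 := H); intros i L.
  rewrite Forall_forall in K; now apply K, nth_In.
Qed.

(** * Sequences of bits *)

Section Sequences.
Variables Fl Fr Fs : pform.
Hypothesis HF : represents Fl Fr Fs.

Let fv_Fl : fv_below 2 Fl := function1_fv _ (l_function _ _ _ HF).
Let fv_Fr : fv_below 2 Fr := function1_fv _ (r_function _ _ _ HF).
Let fv_Fs : fv_below 3 Fs := function2_fv _ (ls_function _ _ _ HF).

Lemma function1_exists F G t : function1 F -> cov G (fun D => exists u, rel D F [t; u]).
Proof.
  intros HF1; assert (H := HA_force _ G (env []) (function1_total _ HF1) t).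
  cbn in H; locally H as [u Hu]; rewrite force_papp in Hu by apply HF1.
  locally; now exists u.
Qed.

Lemma function1_functional F G t u v :
  function1 F -> rel G F [t; u] -> rel G F [t; v] -> eqn G u v.
Proof.
  intros HF1 Hu Hv.
  refine (HA_force _ G (env []) (function1_unique _ HF1) t u v G (incl_refl _) _).
  split; apply force_papp; auto; apply HF1.
Qed.

Lemma function2_exists F G t u :
  function2 F -> cov G (fun D => exists v, rel D F [t; u; v]).
Proof.
  intros HF2; assert (H := HA_force _ G (env []) (function2_total _ HF2) t u).
  cbn in H; locally H as [v Hv]; rewrite force_papp in Hv by apply HF2.
  locally; now exists v.
Qed.

Lemma function2_functional F G t u v w :
  function2 F -> rel G F [t; u; v] -> rel G F [t; u; w] -> eqn G v w.
Proof.
  intros HF2 Hv Hw.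
  refine (HA_force _ G (env []) (function2_unique _ HF2) t u v w G (incl_refl _) _).
  split; apply force_papp; auto; apply HF2.
Qed.

Lemma projections_pair G x y z : rel G Fl [x; y] -> rel G Fr [x; z] -> is_pair G y z x.
Proof.
  intros Hl Hr.
  refine (HA_force _ G (env []) (l_r_pair _ _ _ HF) x y z G (incl_refl _) _).
  split; apply force_papp; auto.
Qed.

(** [l_r_pair] says that [l(x), r(x)] is a pair with code [x]; by injectivity of
    the pairing function it is the only one. *)
Lemma left_pair G y z x : is_pair G y z x -> rel G Fl [x; y].
Proof.
  intros H; locally (function1_exists Fl G x (l_function _ _ _ HF)) as [y' Hl].
  locally (function1_exists Fr D x (r_function _ _ _ HF)) as [z' Hr].
  apply rel_congr2 with x y'; [reflexivity| |assumption].
  apply pair_inj_l with z' z x; [now apply projections_pair | exact H].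
Qed.

Lemma right_pair G y z x : is_pair G y z x -> rel G Fr [x; z].
Proof.
  intros H; locally (function1_exists Fl G x (l_function _ _ _ HF)) as [y' Hl].
  locally (function1_exists Fr D x (r_function _ _ _ HF)) as [z' Hr].
  apply rel_congr2 with x z'; [reflexivity| |assumption].
  apply pair_inj_r with y' y x; [now apply projections_pair | exact H].
Qed.

Lemma iterate_zero G x : rel G Fs [x; Zero; x].
Proof.
  apply (force_papp Fs [1; 0; 1] G (env [Zero; x]) 2); [exact fv_Fs|].
  refine (HA_force _ G (env []) (ls_zero _ _ _ HF) x Zero G (incl_refl _) _).
  cbn; reflexivity.
Qed.

Lemma iterate_succ G x y z w :
  rel G Fs [x; y; z] -> rel G Fl [z; w] -> rel G Fs [x; Succ y; w].
Proof.
  intros Hs Hl.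
  apply (force_papp Fs [4; 2; 0] G (tcons w (tcons z (tcons (Succ y) (tcons y (tcons x (env [])))))) 5);
    [exact fv_Fs|].
  refine (HA_force _ G (env []) (ls_succ _ _ _ HF) x y (Succ y) z w G (incl_refl _) _).
  split; [cbn; reflexivity|]; split; apply force_papp; auto.
Qed.

(** [l_*(x,y+1) = l_*(l(x),y)].  The defining equations peel off the last
    application of [l], this one peels off the first. *)
Lemma iterate_left G x w : rel G Fl [x; w] -> forall y,
  cov G (fun D => exists z, rel D Fs [x; Succ y; z] /\ rel D Fs [w; y; z]).
Proof.
  intros Hw y.
  assert (H : force G (tcons y (env [x; w]))
     (Ex (app Fs [Var 2; Succ (Var 1); Var 0] ∧ app Fs [Var 3; Var 1; Var 0]))).
  - apply force_ind; cbn.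
    + locally; exists w; rewrite !force_app by exact fv_Fs; cbn; split;
        [apply iterate_succ with x; [apply iterate_zero | exact Hw] | apply iterate_zero].
    + intros D v I IH; lift I; locally IH as [z [H1 H2]].
      rewrite !force_app in H1, H2 by exact fv_Fs; cbn in H1, H2.
      locally (function1_exists Fl D0 z (l_function _ _ _ HF)) as [z' Hz].
      locally; exists z'; rewrite !force_app by exact fv_Fs; cbn; split;
        now apply iterate_succ with z.
  - locally H as [z [H1 H2]]; rewrite !force_app in H1, H2 by exact fv_Fs.
    locally; now exists z.
Qed.

Let B := B_form Fr Fs.

Lemma fv_B : fv_below 2 B.
Proof.
  cbn; repeat apply conj; repeat constructor; apply fv_below_papp; auto;
    repeat constructor; auto.
Qed.

Lemma bit_value G u v w b :
  rel G Fs [u; v; w] -> rel G Fr [w; b] -> rel G B [u; v] <-> eqn G b (Succ Zero).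
Proof.
  intros Hw Hb; split.
  - intros H; unfold rel in H; cbn in H.
    locally H as [w' H1]; locally H1 as [z H2]; locally H2 as [o [Hz [Ho [Hs Hr]]]].
    rewrite force_papp in Hs, Hr by assumption; cbn in Hs, Hr.
    transitivity o; [|now rewrite <- Ho, Hz].
    apply function1_functional with Fr w; [apply HF|assumption|].
    apply rel_congr2 with w' o; [|reflexivity|exact Hr].
    apply function2_functional with Fs u v; auto; apply HF.
  - intros E; unfold rel; cbn.
    locally; exists w; locally; exists Zero; locally; exists (Succ Zero).
    rewrite !force_papp by assumption; cbn.
    repeat split; [reflexivity|reflexivity|exact Hw|].
    apply rel_congr2 with w b; [reflexivity|assumption|assumption].
Qed.

Lemma bit_pair_zero G v a x :
  is_pair G v a x -> rel G B [x; Zero] <-> eqn G a (Succ Zero).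
Proof.
  intros H; apply bit_value with x; [apply iterate_zero | now apply right_pair with v].
Qed.

Lemma bit_pair_succ G v a x y :
  is_pair G v a x -> rel G B [x; Succ y] <-> rel G B [v; y].
Proof.
  intros H; apply left_pair in H.
  assert (K := iterate_left G x v H y).
  split; intros HB; locally K as [w [H1 H2]];
    locally (function1_exists Fr D w (r_function _ _ _ HF)) as [b Hb];
    revert HB; rewrite (bit_value _ _ _ w b), (bit_value _ _ _ w b); auto.
Qed.

(** [D ⊢ ¬ A] appears as the absurdity of [A] in all contexts above [D]. *)
Lemma eq_one_decidable G t :
  cov G (fun D => eqn D t (Succ Zero) \/
                  forall E, incl D E -> eqn E t (Succ Zero) -> E ⊢ Bot).
Proof.
  locally (zero_or_succ G t) as [Z|[u E]].
  - locally; right; intros E J H; lift J.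
    apply succ_zero_absurd with Zero; now rewrite <- H.
  - locally (zero_or_succ D u) as [Z|[w E']].
    + locally; left; now rewrite E, Z.
    + locally; right; intros F J H; lift J.
      apply succ_zero_absurd with w, succ_inj; now rewrite <- E', <- E.
Qed.

Lemma bit_decidable G u v :
  cov G (fun D => rel D B [u; v] \/ forall E, incl D E -> rel E B [u; v] -> E ⊢ Bot).
Proof.
  locally (function2_exists Fs G u v (ls_function _ _ _ HF)) as [w Hw].
  locally (function1_exists Fr D w (r_function _ _ _ HF)) as [b Hb].
  locally (eq_one_decidable D0 b) as [K|K].
  - locally; left; now apply (bit_value _ u v w b).
  - locally; right; intros E J H; lift J.
    apply (K E); [assumption|].
    exact (proj1 (bit_value E u v w b Hw Hb) H).
Qed.

(** * Comprehension *)

Lemma force_bot G τ A : G ⊢ Bot -> force G τ A.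
Proof. intros H; now apply force_prv, prv_botE. Qed.

Section Comprehension.
Variables (C : aform) (σ : nat -> term).

(** What forcing makes of the formula [codes_form] below. *)
Definition codes (G : list aform) (z k v : term) : Prop :=
  forall x D, incl G D -> cov D (fun E => exists d, eqn E (Succ (Plus d x)) z) ->
    (forall E, incl D E -> rel E B [v; x] -> force E (tcons (Plus x k) σ) C) /\
    (forall E, incl D E -> force E (tcons (Plus x k) σ) C -> rel E B [v; x]).

(** Indices 0, 1, 2 are [v, k, z]; the higher ones are the parameters of [C]. *)
Definition codes_form : aform :=
  All (Ex (Succ (Plus (Var 0) (Var 1)) ≈ Var 4) ⇒
       (app B [Var 1; Var 0]
        ⇔ asubst (tcons (Plus (Var 0) (Var 2)) (fun n => Var (4 + n))) C)).

Lemma force_codes G z k v :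
  force G (tcons v (tcons k (tcons z σ))) codes_form <-> codes G z k v.
Proof.
  assert (HC : forall D x, force D (tcons x (tcons v (tcons k (tcons z σ))))
            (asubst (tcons (Plus (Var 0) (Var 2)) (fun n => Var (4 + n))) C) <->
          force D (tcons (Plus x k) σ) C).
  { intros D x; rewrite force_asubst; apply force_ext; now intros [|n]. }
  cbn [force codes_form Iff]; unfold codes.
  split; intros H x D I HD; destruct (H x D I HD) as [H1 H2]; split; intros E J HE.
  - apply HC, H1; auto; now apply force_app; [exact fv_B|].
  - apply (force_app B [Var 1; Var 0] E (tcons x (tcons v (tcons k (tcons z σ))))); [exact fv_B|].
    apply H2; auto; now apply HC.
  - apply HC, H1; auto; now apply force_app in HE; [|exact fv_B].
  - apply force_app; [exact fv_B|]; apply H2; auto; now apply HC.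
Qed.

Lemma codes_mono G D z k v : codes G z k v -> incl G D -> codes D z k v.
Proof. intros H I x E J; apply H; eauto using incl_tran. Qed.

Lemma codes_zero G k v : codes G Zero k v.
Proof.
  intros x D I H; split; intros E J _; lift J; locally H as [d Hd];
    apply force_bot, (succ_zero_absurd _ _ Hd).
Qed.

(** Bit 0 of [x] is [a], which answers [C(0+k)]; bit [j+1] of [x] is bit [j] of
    [v], which answers [C(j+(k+1))], that is, [C((j+1)+k)]. *)
Lemma codes_pair G z k v a x :
  codes G z (Succ k) v -> is_pair G v a x ->
  (forall D, incl G D -> eqn D a (Succ Zero) <-> force D (tcons k σ) C) ->
  codes G (Succ z) k x.
Proof.
  intros Hv Hx Ha i D I Hi; lift I.
  split; intros E J H; lift J; locally (zero_or_succ E i) as [Z|[j Z]].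
  - apply eqn_replace with k; [rewrite Z; symmetry; apply plus_0_l|].
    refine (proj1 (Ha D0 _) _); [assumption|].
    apply (proj1 (bit_pair_zero D0 v a x Hx)).
    now apply rel_congr2 with x i.
  - locally Hi as [d Hd].
    apply eqn_replace with (Plus j (Succ k)); [rewrite Z; arith_ring|].
    refine (proj1 (Hv j D1 _ _) D1 (incl_refl _) _); [assumption| |].
    + locally; exists d; apply succ_inj; rewrite <- Hd, Z; arith_ring.
    + apply (proj1 (bit_pair_succ D1 v a x j Hx)); now apply rel_congr2 with x i.
  - apply rel_congr2 with x Zero; [reflexivity|now symmetry|].
    apply (proj2 (bit_pair_zero D0 v a x Hx)).
    refine (proj2 (Ha D0 _) _); [assumption|].
    apply eqn_replace with (Plus i k); [rewrite Z; apply plus_0_l|assumption].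
  - locally Hi as [d Hd].
    apply rel_congr2 with x (Succ j); [reflexivity|now symmetry|].
    apply (proj2 (bit_pair_succ D1 v a x j Hx)).
    refine (proj2 (Hv j D1 _ _) D1 (incl_refl _) _); [assumption| |].
    + locally; exists d; apply succ_inj; rewrite <- Hd, Z; arith_ring.
    + apply eqn_replace with (Plus i k); [rewrite Z; arith_ring|assumption].
Qed.

(** By induction on the length [z].  This is the forced form of a double negation:
    the existence of a code is absurd in no consistent context. *)
Lemma comprehension G z k :
  (forall E, incl G E -> cov E (fun F => exists v, codes F z k v) -> E ⊢ Bot) ->
  G ⊢ Bot.
Proof.
  assert (H : force G (tcons z σ) (All (¬ ¬ Ex codes_form))).
  - apply force_ind; cbn [force Neg].
    + intros t D I H; apply H; [apply incl_refl|].
      locally; exists Zero; apply force_codes, codes_zero.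
    + (* The shift [k] changes in the induction step, so it is quantified in the
         induction formula. *)
      clear z k; intros D z I IH k E J N.
      apply (IH (Succ k) E J); intros E1 J1 Hv; locally Hv as [v Hv'].
      rewrite force_codes in Hv'.
      assert (key : forall F a, incl D0 F ->
        (forall F', incl F F' -> eqn F' a (Succ Zero) <-> force F' (tcons k σ) C) ->
        F ⊢ Bot).
      { intros F a JF Ha; locally (pair_exists F v a) as [x Hx].
        apply N; [eauto using incl_tran|].
        locally; exists x; apply force_codes, codes_pair with v a; auto.
        - apply codes_mono with D0; eauto using incl_tran.
        - intros L JL; apply Ha; eauto using incl_tran. }
      (* The bit 1 refutes [C(k)], so the bit 0 is right. *)
      apply (key D0 Zero (incl_refl _)); intros F JF; split; intros HF'.
      * apply force_bot, (succ_zero_absurd _ Zero); now symmetry.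
      * apply prv_botE, (key F (Succ Zero)); auto.
        intros F' JF'; split; intros _; [now apply force_mono with F | reflexivity].
  - intros N; apply (H k G (incl_refl G)); intros E J HE; apply (N E J).
    locally HE as [v Hv]; rewrite force_codes in Hv; locally; exists v.
    eapply codes_mono; eassumption.
Qed.
End Comprehension.
End Sequences.

(** * The formula [Q] holds in arithmetic *)

Lemma Q_true G Fl Fr Fs :
  is_G G -> represents Fl Fr Fs -> HA (circ (Q_form G Fr Fs)).
Proof.
  intros HG HF; apply force_closed; intros σ.
  assert (fvB := fv_B Fl Fr Fs HF); assert (fvG := G_fv _ HG).
  unfold circ, Q_form, all2, all3, all4, all5; cbn [bigand instance].
  repeat apply conj; cbn.
  - intros t u v D _ [H K]; apply succ_inj; now rewrite H.
  - intros t u D _ H E I K; lift I; apply succ_zero_absurd with t; now rewrite H.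
  - intros t u v D _ [H K]; now rewrite <- H.
  - intros t u v D _ [H K]; now rewrite <- H.
  - intros t u D _ H; rewrite H; apply plus_0_r.
  - intros t u v w z D _ [H [K L]]; now rewrite <- H, <- L, <- K, plus_S_r.
  - intros t u D _ H; rewrite H; apply mult_0_r.
  - intros t u v w z D _ [H [K L]]; now rewrite <- H, <- L, <- K, mult_S_r.
  - intros t u v w D _ [H K]; now rewrite <- H.
  - intros t u v w D _ [H K]; now rewrite <- H.
  - intros t u v w D _ [H K]; now rewrite <- H.
  - intros t u v w D _ [H K]; now rewrite <- H.
  - intros t; locally (zero_or_succ [] t) as [H|[u H]]; locally; [now left|].
    right; locally; now exists u.
  - locally; now exists Zero.
  - intros t u D _ [H K]; now rewrite K.
  - intros t u D _ [H K]; now rewrite <- H.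
  - intros t; locally; now exists (Succ t).
  - intros t u v D _ [H K]; now rewrite <- H.
  - intros t u v D _ [H K]; now rewrite H.
  - intros t u; locally; now exists (Plus t u).
  - intros t u v w D _ [H K]; now rewrite <- H.
  - intros t u v w D _ [H K]; now rewrite H.
  - intros t u; locally; now exists (Mult t u).
  - intros t u v w D _ [H K]; now rewrite <- H.
  - intros t u v w D _ [H K]; now rewrite H.
  - intros t u v w D I [H K].
    refine (HA_force _ D σ (G_functional _ HG) t u v w D (incl_refl _) (conj H K)).
  - intros y z D _ N.
    (* [x ≤ z] is [x < z+1], and [H(y,x)] is [G(y,x,0)], taken with shift 0. *)
    assert (HC : forall E x k, force E (tcons (Plus x k) (env [y])) (app G [Var 1; Var 0; Zero])
                   <-> rel E G [y; Plus x k; Zero])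
      by (intros; now rewrite force_app).
    apply (comprehension Fl Fr Fs HF (app G [Var 1; Var 0; Zero]) (env [y])
             D (Succ z) Zero).
    intros E I N'; apply (N E I); locally N' as [v Hv]; locally; exists v.
    intros x F J Hx.
    destruct (Hv x F) as [H1 H2]; [eauto using incl_tran| |].
    { locally Hx as [d Hd]; locally; exists d; now apply Succ_proper. }
    split; intros K L H.
    + rewrite force_papp in H by exact fvB.
      assert (H' := proj1 (HC K x Zero) (H1 K L H)).
      locally; exists Zero; split; [reflexivity|].
      apply force_papp; [exact fvG|]; cbn.
      revert H'; apply rel_congr; repeat apply Forall2_cons; try reflexivity; [apply plus_0_r|auto].
    + apply force_papp; [exact fvB|]; apply (H2 K L), HC.
      locally H as [o [Ho H']]; rewrite force_papp in H' by exact fvG; cbn in H'.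
      revert H'; apply rel_congr; repeat apply Forall2_cons; auto; try reflexivity.
      symmetry; apply plus_0_r.
  - intros u v; locally (bit_decidable Fl Fr Fs HF [] u v) as [H|H]; locally.
    + left; now apply force_papp.
    + right; intros E J K; rewrite force_papp in K by exact fvB.
      apply (H E); [eauto using incl_tran | exact K].
Qed.

(** * Substitutional instances of [nCT*] *)

Definition ar_symbols : list (nat * nat) := [(0, 1); (0, 2); (1, 2); (0, 3); (1, 3)].

Fixpoint ar (A : pform) : Prop :=
  match A with
  | Atom (i, args) => In (i, length args) ar_symbols
  | Bot => True
  | And A B | Or A B | Imp A B => ar A /\ ar B
  | All A | Ex A => ar A
  end.

Lemma delta0_ar A : delta0 A -> ar A.
Proof. induction 1; cbn; tauto. Qed.

Lemma sigma_ar A : sigma A -> ar A.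
Proof. induction 1; cbn; auto using delta0_ar; tauto. Qed.

Lemma ar_papp A args : ar A -> ar (papp A args).
Proof.
  unfold papp; generalize (fun n => nth n args 0) as r.
  induction A as [[i l]| | | | | |]; cbn [ar prename]; intros r H;
    rewrite ?length_map; intuition.
Qed.

Lemma instance_ar Psi : (forall i k, In (i, k) ar_symbols -> Psi i k = arith i k) ->
  forall A, ar A -> forall d e, instance Psi d A = instance arith e A.
Proof.
  intros HPsi A; induction A as [[i args]| | | | | |]; cbn [ar instance]; intros H d e;
    try (f_equal; intuition; fail).
  rewrite HPsi by exact H.
  destruct i as [|[|i]], args as [|x [|y [|z [|w args]]]]; reflexivity.
Qed.

Lemma Q_ar G Fl Fr Fs : is_G G -> represents Fl Fr Fs -> ar (Q_form G Fr Fs).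
Proof.
  intros HG HF; cbn.
  assert (ar G) by apply sigma_ar, HG.
  assert (ar Fr) by (apply sigma_ar; apply HF).
  assert (ar Fs) by (apply sigma_ar; apply HF).
  assert (ar (B_form Fr Fs)) by (cbn; repeat split; auto 8 using ar_papp).
  repeat first [apply ar_papp; assumption | split]; auto 8.
Qed.

(** Reads [Z, E, S, A, M] arithmetically, [P] as [Phi] and [R] as [Psi].  The
    arguments [x, y] of [R] are indices 0, 1, but indices 1, 0 of [Psi]. *)
Definition reading (Phi Psi : aform) (i k : nat) : aform :=
  match i, k with
  | 1, 1 => Phi
  | 2, 2 => asubst (fun n => match n with
                             | 0 => Var 1
                             | 1 => Var 0
                             | S (S m) => Var (S (S m))
                             end) Psi
  | _, _ => arith i k
  end.

Lemma reading_ar Phi Psi A d e : ar A -> instance (reading Phi Psi) d A = instance arith e A.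
Proof.
  intros H; apply instance_ar; [|exact H].
  intros i k [E|[E|[E|[E|[E|[]]]]]]; injection E as <- <-; reflexivity.
Qed.

Lemma EqPR_true Phi Psi : HA (instance (reading Phi Psi) 0 EqPR).
Proof.
  apply force_closed; intros σ; cbn; split.
  - intros x y D _ E F I; lift I; rewrite !force_asubst; apply force_congr.
    intros [|n]; cbn; [exact E|]; destruct n; reflexivity.
  - intros x y x' y' D _ [E E'] F I; lift I; rewrite !force_asubst; apply force_congr.
    intros [|[|n]]; cbn; try assumption; destruct n; reflexivity.
Qed.

Lemma reading_nCT G Phi Psi : is_G G ->
  let Phi' :=
    asubst (fun n => match n with 0 => Var 0 | S m => Var (S (S m)) end) Phi in
  let Psi' :=
    asubst (fun n => match n with
                     | 0 => Var 0
                     | 1 => Var 1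
                     | S (S m) => Var (S (S (S m)))
                     end) Psi in
  instance (reading Phi Psi) 0 (nCT G) =
  (All (¬ Phi ⇒ Ex Psi)
   ⇒ Ex (All (¬ Phi' ⇒ Ex (circ (papp G [2; 1; 0]) ∧ Psi'))))%form.
Proof.
  intros HG Phi' Psi'; unfold circ, nCT, Neg; cbn [instance pP pR length reading].
  rewrite (reading_ar _ _ (papp G [2; 1; 0]) 3 0) by (apply ar_papp, sigma_ar, HG).
  rewrite !asubst_comp.
  repeat f_equal; try apply asubst_id; try apply asubst_ext.
  all: intros [|[|n]]; cbn; try reflexivity.
  all: destruct n; cbn; f_equal; lia.
Qed.

Theorem theorem5p4 :
  forall (G Fl Fr Fs : pform),
    is_G G -> represents Fl Fr Fs ->
    forall A : aform, MA G A -> CA G Fr Fs A.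
Proof.
  intros G Fl Fr Fs HG HF A; apply prv_axioms; intros X [HX | HX].
  { apply prv_ax; now left. }
  assert (HA_CA : forall Y, HA Y -> CA G Fr Fs Y)
    by (intros Y; apply prv_axioms; intros; apply prv_ax; now left).
  destruct HX as [Phi | Phi Psi Phi' Psi'].
  - assert (H := MQC_Markov G Fr Fs (fun _ _ => Phi)); cbn in H.
    rewrite !(asubst_id Phi) in H; [apply prv_ax; now right|].
    intros [|n]; cbn; [reflexivity|].
    destruct n; cbn; rewrite ?Nat.add_1_r; reflexivity.
  - assert (H := MQC_nCT_star G Fr Fs (reading Phi Psi)).
    unfold nCT_star in H; cbn [instance] in H.
    rewrite reading_nCT, (reading_ar _ _ (Q_form G Fr Fs) 0 0) in H
      by eauto using Q_ar.
    apply prv_impE with (2 := prv_andI _ _ _ _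
      (HA_CA _ (Q_true G Fl Fr Fs HG HF)) (HA_CA _ (EqPR_true Phi Psi))).
    apply prv_ax; now right.
Qed.
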